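(* There is a family $(G_n)_{n\ge 1}$ of finite supersolvable metabelian groups such that $$\frac{|\rho^{*}(G_n)|}{\sigma^{*}(G_n)}\longrightarrow 2\qquad\text{as } n\to\infty.$$
   Context: Let $G$ be a finite group and $x\in G$. Denote by $G_x$ the smallest subnormal subgroup of $G$ containing $x$ (that is, the intersection of all subnormal subgroups of $G$ containing $x$). The sub-class of $x$ in $G$ is $x^{G^{*}}:=x^{G_x}=\{x^g: g\in G_x\}$, the conjugacy class of $x$ in the group $G_x$; its size $|x^{G^{*}}|=[G_x:C_{G_x}(x)]$ is called a sub-class size of $G$. For a positive integer $n$, $\pi(n)$ denotes the set of prime divisors of $n$. Set $$\rho^{*}(G)=\bigcup_{x\in G}\pi\bigl(|x^{G^{*}}|\bigr),\qquad \sigma^{*}(G)=\max_{x\in G}\bigl|\pi\bigl(|x^{G^{*}}|\bigr)\bigr|.$$ A group is metabelian if its derived subgroup is abelian. A finite group is supersolvable if it has a series of subgroups, each normal in the whole group, from the trivial subgroup to the whole group, with cyclic factors. *)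

(* Defs.v *)
From mathcomp Require Import all_boot all_fingroup all_solvable.

Set Implicit Arguments.
Unset Strict Implicit.
Unset Printing Implicit Defensive.

Local Open Scope group_scope.

Section SubClass.

Variable gT : finGroupType.
Implicit Types (G : {group gT}) (x : gT).

(* The group written G_x; it is only meaningful for x \in G, in which case G  *)
(* itself is one of the groups intersected.                                   *)
Definition subnormal_closure G x : {set gT} :=
  \bigcap_(H : {group gT} | (H <|<| G) && (x \in H)) H.

Canonical subnormal_closure_group G x :=
  Eval hnf in [group of subnormal_closure G x].

Definition sub_class G x : {set gT} := x ^: subnormal_closure G x.

(* The finite set rho^*(G), as a duplicate-free sequence of primes. *)
Definition rho_star G : seq nat :=
  undup (flatten [seq primes #|sub_class G x| | x <- enum G]).

Lemma mem_rho_star G p :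
  reflect (exists2 x, x \in G & p \in \pi(#|sub_class G x|)%N)
          (p \in rho_star G).
Proof.
rewrite mem_undup; apply: (iffP flatten_mapP) => -[x Gx px]; exists x => //.
  by rewrite mem_enum in Gx.
by rewrite mem_enum.
Qed.

Definition sigma_star G : nat :=
  (\max_(x in G) size (primes #|sub_class G x|))%N.

Definition metabelian G : bool := abelian G^`(1).

Definition normal_cyclic_factor (A V U : {set gT}) : bool :=
  [&& V <| A, U <| A, V \subset U & cyclic (U / V)].

Definition supersolvable G : Prop :=
  exists2 s : seq {group gT},
    (normal_cyclic_factor G).-series 1%G s & last 1%G s = G.

End SubClass.

(* Main.v *)
(* Take one odd prime p_v for each linear form v on H = F_2^(n+1), and let H act
   on the cyclic group A of order \prod_v p_v, the element a inverting the
   p_v-part when <a, v> <> 0 and centralising it otherwise.  If M_a is the part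
   of A inverted by a, then the subnormal closure of x = f a in A H is M_a <x>,
   where x centralises <x> and acts regularly on M_a, so the sub-class of x has
   size |M_a|.  Its prime divisors are the p_v with <a, v> <> 0: there are 2^n of
   them if a <> 0, while all the 2^(n+1) - 1 primes with v <> 0 occur for some a.
   Hence the ratio is 2 - 2^-n. *)

Require Import Defs.
From mathcomp Require Import all_boot all_order all_algebra all_fingroup.
From mathcomp Require Import all_solvable.

Set Implicit Arguments.
Unset Strict Implicit.
Unset Printing Implicit Defensive.

Local Open Scope group_scope.

(** * Supersolvability of cyclic-by-abelian groups *)

(** Every subgroup between [A] and [G] contains the derived subgroup, so it is normal in [G].
    Adjoining elements to [A] one at a time therefore yields normal subgroups with cyclic
    factors. *)
Lemma supersolvable_cyclic_by_abelian (gT : finGroupType) (G A : {group gT}) :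
  A <| G -> cyclic A -> abelian (G / A) -> supersolvable G.
Proof.
move=> nsAG cycA abGA; have sG'A := der1_min (normal_norm nsAG) abGA.
have nsG (K : {group gT}) : A \subset K -> K \subset G -> K <| G.
  by move=> sAK; apply: sub_der1_normal; apply: subset_trans sAK.
(* Induction on a bound for [#|G| - #|K|], where [K] is the term that the partial series has
   reached; it starts from [1 <= A]. *)
suff extend m (K : {group gT}) (s : seq {group gT}) :
    #|G| - #|K| < m -> A \subset K -> K \subset G ->
    (normal_cyclic_factor G).-series 1%G s -> last 1%G s = K -> supersolvable G.
- apply: (extend _ A [:: A] (ltnSn _)) => //; first exact: normal_sub.
  by rewrite /= andbT /normal_cyclic_factor normal1 nsAG sub1G /= quotient_cyclic.
elim: m K s => // m IHm K s ltm sAK sKG series_s last_s.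
have [sGK | /subsetPn[x Gx notKx]] := boolP (G \subset K).
  by exists s => //; rewrite last_s; apply/group_inj/eqP; rewrite eqEsubset sKG.
pose L := (K <*> <[x]>)%G.
have sKL : K \subset L := joing_subl _ _.
have sLG : L \subset G by rewrite join_subG sKG cycle_subG.
have sAL := subset_trans sAK sKL.
apply: (IHm L (rcons s L)) => //; last by rewrite last_rcons.
  have ltKL : #|K| < #|L|.
    apply: proper_card; apply/properP; split=> //; exists x => //.
    by rewrite mem_gen // inE cycle_id orbT.
  have leLG := subset_leq_card sLG.
  by apply: leq_trans (ltn_sub2l (leq_trans ltKL leLG) ltKL) _.
rewrite rcons_path series_s last_s /= /normal_cyclic_factor !nsG // sKL /=.
have nKx : <[x]> \subset 'N(K).
  by rewrite cycle_subG (subsetP (normal_norm (nsG K sAK sKG))).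
by rewrite quotientYidl // quotient_cyclic ?cycle_cyclic.
Qed.

(** * Subnormal closure and sub-class of an element acting regularly *)

Section CommutatorClass.

Variables (gT : finGroupType) (G M : {group gT}) (x : gT).
Hypotheses (abelM : abelian M) (nMx : x \in 'N(M)) (regMx : 'C_M[x] = 1).

Lemma commg_inj_regular : {in M &, injective (fun m => [~ m, x])}.
Proof.
move=> m n Mm Mn; rewrite /= !commgEl => eq_mn; apply/eqP.
have Mc : m * n^-1 \in M by rewrite groupM ?groupV.
have : m * n^-1 \in 'C_M[x].
  rewrite in_setI Mc; apply/cent1P/commgP/conjg_fixP.
  rewrite conjMg conjVg.
  have -> : m ^ x = m * n^-1 * n ^ x.
    by rewrite -mulgA -eq_mn mulgA mulgV mul1g.
  by rewrite mulgK.
by rewrite regMx => /set1gP/(canRL (mulgKV _)) ->; rewrite mul1g.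
Qed.

(** An injective map from the finite set [M] to itself is onto, so every element of [M] is a
    commutator with [x]. *)
Lemma commg_image_regular : [set [~ m, x] | m in M] = M.
Proof.
apply/eqP; rewrite eqEcard (card_in_imset commg_inj_regular) leqnn andbT.
apply/subsetP=> _ /imsetP[m Mm ->].
by rewrite commgEl groupM ?groupV // memJ_norm.
Qed.

(** Descend along the subnormal series: if [K] is normal in [L] and [M] lies in [L], each [[~ m, x]]
    is a product of a conjugate of [x^-1] and [x], hence lies in [K], and these commutators fill
    [M]. *)
Lemma regular_sub_subnormal (K : {group gT}) :
  M \subset G -> K <|<| G -> x \in K -> M \subset K.
Proof.
move=> sMG /subnormalP[s]; elim: s K => [|L s IHs] K /=; first by move=> _ ->.
case/andP=> /andP[sKL nKL] series_s last_s Kx.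
have sML := IHs L series_s last_s (subsetP sKL x Kx).
rewrite -commg_image_regular; apply/subsetP=> _ /imsetP[m Mm ->].
rewrite commgEr groupM // memJ_norm ?groupV //.
exact: (subsetP nKL) _ (subsetP sML _ Mm).
Qed.

End CommutatorClass.

(** The subnormal closure of [x] is [M<x>]. It is normal in [A<x>] since [[A, x]] lies in [M], and
    [A<x>] is normal in [G] since it contains the derived subgroup; minimality is
    [regular_sub_subnormal]. *)
Lemma card_sub_class_regular (gT : finGroupType) (G A M : {group gT}) x :
    A <| G -> abelian A -> abelian (G / A) -> x \in G -> M \subset A ->
    x \in 'N(M) -> [~: A, [set x]] \subset M -> 'C_M[x] = 1 ->
  #|sub_class G x| = #|M|.
Proof.
move=> nsAG abelA abGA Gx sMA nMx sAxM regMx.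
have abelM := abelianS sMA abelA.
have sG'A := der1_min (normal_norm nsAG) abGA.
have sMG := subset_trans sMA (normal_sub nsAG).
pose U := (M <*> <[x]>)%G; pose L := (A <*> <[x]>)%G.
have defU : M * <[x]> = U by rewrite /= norm_joinEr // cycle_subG.
have nAx : <[x]> \subset 'N(A) by rewrite cycle_subG (subsetP (normal_norm nsAG)).
have Lx : x \in L by rewrite mem_gen // inE cycle_id orbT.
have Ux : x \in U by rewrite mem_gen // inE cycle_id orbT.
have sMU : M \subset U := joing_subl _ _.
have nsLG : L <| G.
  apply: sub_der1_normal; first by apply: subset_trans sG'A (joing_subl _ _).
  by rewrite join_subG (normal_sub nsAG) cycle_subG.
have nsUL : U <| L.
  rewrite /normal join_subG cycle_subG Lx (subset_trans sMA (joing_subl _ _)) /=.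
  rewrite join_subG cycle_subG (subsetP (normG _)) // andbT.
  apply/subsetP=> a Aa; rewrite inE -[X in X :^ _]defU conjsMg.
  rewrite mul_subG //; apply/subsetP=> _ /imsetP[y My ->].
    apply: (subsetP sMU).
    by rewrite /conjg -(centsP abelA a Aa y) ?mulKg // ?(subsetP sMA).
  have : x ^ a \in U.
    rewrite conjg_mulR groupM // (subsetP sMU) // -invg_comm groupV.
    by rewrite (subsetP sAxM) // mem_commg ?set11.
  by case/cycleP: My => i -> Uxa; rewrite conjXg groupX.
have defGx : subnormal_closure G x = U.
  apply/eqP; rewrite eqEsubset; apply/andP; split.
    apply: bigcap_inf; rewrite Ux andbT.
    exact: subnormal_trans (normal_subnormal nsUL) (normal_subnormal nsLG).
  apply/bigcapsP=> K /andP[snK Kx]; rewrite join_subG cycle_subG Kx andbT.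
  exact: (regular_sub_subnormal nMx regMx sMG).
have -> : sub_class G x = [set x ^ m | m in M].
  (* With [U] written as [<[x]> * M], the power of [x] acts first and fixes [x], so only the factor
     in [M] matters. *)
  rewrite /sub_class defGx -defU -normC ?cycle_subG //.
  apply/setP=> y; apply/imsetP/imsetP=> -[].
    move=> _ /mulsgP[z m xz Mm ->] ->; exists m => //.
    rewrite conjgM (_ : x ^ z = x) //; case/cycleP: xz => i ->.
    exact/conjg_fixP/commgP/commuteX.
  by move=> m Mm ->; exists m; rewrite //= -[m]mul1g mem_mulg.
rewrite card_in_imset // => m n Mm Mn eq_mn.
(* The element [x ^ m] determines [[~ x, m]], hence its inverse [[~ m, x]]. *)
apply: (commg_inj_regular regMx) => //=.
by rewrite -[[~ m, x]]invg_comm -[[~ n, x]]invg_comm !commgEl eq_mn.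
Qed.

(** * Products of distinct primes *)

Lemma primes_prod_distinct (I : finType) (p : I -> nat) (P : pred I) :
    (forall i, prime (p i)) -> injective p ->
  perm_eq (primes (\prod_(i | P i) p i)%N) [seq p i | i <- enum P].
Proof.
move=> p_pr p_inj; apply: uniq_perm; first exact: primes_uniq.
  by rewrite map_inj_uniq ?enum_uniq.
move=> q; rewrite mem_primes prodn_cond_gt0 /=; last first.
  by move=> i _; exact: prime_gt0.
apply/andP/mapP=> [[q_pr] | [i]].
  rewrite Euclid_dvd_prod // big_orE => /existsP[i /andP[Pi]].
  rewrite dvdn_prime2 // => /eqP ->.
  by exists i => //; rewrite mem_enum.
by rewrite mem_enum => Pi ->; split=> //; rewrite (bigD1 i) //= dvdn_mulr.
Qed.

Lemma dvdn_prod_distinct_primes (I : finType) (p : I -> nat) n :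
    (forall i, prime (p i)) -> injective p -> (forall i, p i %| n) ->
  (\prod_i p i %| n)%N.
Proof.
move=> p_pr p_inj p_dvd; rewrite -big_enum /=.
elim: (enum I) (enum_uniq I) => [_ | i s IHs /= /andP[s'i s_uniq]].
  by rewrite big_nil dvd1n.
rewrite big_cons Gauss_dvd; first by rewrite p_dvd IHs.
rewrite prime_coprime // Euclid_dvd_prod // big_has.
apply: contra s'i => /hasP[j sj]; rewrite dvdn_prime2 // => /eqP/p_inj -> //.
Qed.

(** * Semidirect products by coordinatewise inversion *)

Section SignAction.

Variables (I : finType) (p : I -> nat) (aT : finGroupType).
Variable e : aT -> I -> bool.
Hypothesis p_pr : forall i, prime (p i).
Hypothesis p_odd : forall i, odd (p i).
Hypothesis p_inj : injective p.
Hypothesis eM : forall a b i, e (a * b) i = e a i (+) e b i.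
Hypothesis abel_aT : abelian [set: aT].

(** The cyclic group [A] is encoded as a direct product, so that its part for the prime [p i] is
    simply coordinate [i]. *)
Let K : finGroupType := {dffun forall i, 'Z_(p i)}.

Definition sign_act (f : K) (a : aT) : K :=
  [ffun i => if e a i then (f i)^-1 else f i].

Lemma sign_act1 : sign_act^~ 1 =1 id.
Proof.
move=> f; apply/ffunP=> i; rewrite ffunE.
(* Additivity at [1 * 1] forces [e 1 i] to be false. *)
by have := eM 1 1 i; rewrite mulg1; case: (e 1 i).
Qed.

Lemma sign_actM f : act_morph sign_act f.
Proof.
move=> a b; apply/ffunP=> i; rewrite !ffunE eM.
by case: (e a i); case: (e b i); rewrite /= ?invgK.
Qed.

Definition sign_action := TotalAction sign_act1 sign_actM.

Lemma abelian_dffun : abelian [set: K].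
Proof.
apply/centsP=> f _ g _; apply/ffunP=> i; rewrite !ffunE.
exact: GRing.addrC.
Qed.

Lemma sign_is_groupAction : is_groupAction [set: K] sign_action.
Proof.
move=> a _; rewrite inE; apply/andP; split.
  by apply/subsetP=> f _; rewrite inE.
apply/morphicP=> f g _ _; rewrite !actpermE /=.
apply/ffunP=> i; rewrite !ffunE; case: (e a i) => //.
by rewrite invMg; exact: GRing.addrC.
Qed.

Definition sign_groupAction := GroupAction sign_is_groupAction.

(** The element with all coordinates 1 generates: its order is divisible by each of the distinct
    primes [p i], hence by their product, the order of the group. *)
Lemma cyclic_dffun : cyclic [set: K].
Proof.
pose g : K := [ffun i => Zp1].
apply/cyclicP; exists g; apply/eqP; rewrite eq_sym eqEcard subsetT /=.
rewrite -[[set: K]](_ : setXn (fun i => [set: 'Z_(p i)]) = _); last first.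
  by apply/setP=> f; rewrite in_setT; apply/setXnP=> i; rewrite in_setT.
rewrite cardsXn; apply: dvdn_leq; first exact: order_gt0.
under eq_bigr => i _ do rewrite cardsT card_ord Zp_cast ?prime_gt1 //.
apply: dvdn_prod_distinct_primes => // i.
have := congr1 (fun f : K => f i) (expg_order g).
rewrite oneg_ffun -[(g ^+ _) i]/(dffun_morphism _ i (g ^+ _)) morphX ?inE //=.
(* The modulus of ['Z_(p i)] is [(Zp_trunc (p i)).+2], which equals [p i] because [p i > 1]. *)
rewrite /g ffunE => /eqP; rewrite -order_dvdn order_Zp1 -[_.-2.+2]/(Zp_trunc (p i)).+2.
by rewrite Zp_cast ?prime_gt1.
Qed.

Local Notation sdT := (sdprod_by sign_groupAction).
Local Notation in1 := (sdpair1 sign_groupAction).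
Local Notation in2 := (sdpair2 sign_groupAction).
Let A := (in1 @* [set: K])%G.

Lemma normal_sign_kernel : A <| [set: sdT].
Proof. by case/sdprod_context: (sdprod_sdpair sign_groupAction). Qed.

Lemma abelian_sign_quotient : abelian ([set: sdT] / A).
Proof.
rewrite -(isog_abelian (sdprod_isog (sdprod_sdpair sign_groupAction))).
exact: morphim_abelian.
Qed.

Lemma cyclic_sign_kernel : cyclic A.
Proof. exact: morphim_cyclic cyclic_dffun. Qed.

Definition moved (a : aT) : {group K} :=
  [group of setXn (fun i => if e a i then [set: 'Z_(p i)]%G else 1%G)].

Lemma card_moved a : #|moved a| = (\prod_(i | e a i) p i)%N.
Proof.
rewrite cardsXn [RHS]big_mkcond; apply: eq_bigr => i _.
case: (e a i); rewrite ?cards1 //.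
by rewrite cardsT card_ord Zp_cast ?prime_gt1.
Qed.

(** The component of [u] in the abelian kernel acts trivially, so only [u.1] matters. *)
Lemma sdpair1J (f : K) (u : sdT) : in1 f ^ u = in1 (sign_act f u.1).
Proof.
rewrite {1}[u]sdpairE conjgM -sdpair_act ?inE //=.
have /centsP cA : abelian (in1 @* [set: K]) by exact: morphim_abelian abelian_dffun.
by rewrite /conjg -(cA (in1 u.2)) ?mulKg // mem_morphim ?inE.
Qed.

Lemma card_sub_class_sign (u : sdT) :
  #|sub_class [set: sdT]%G u| = (\prod_(i | e u.1 i) p i)%N.
Proof.
have sMA : in1 @* moved u.1 \subset A by rewrite morphimS ?subsetT.
rewrite -card_moved -(card_injm (injm_sdpair1 sign_groupAction)) ?subsetT //.
apply: (card_sub_class_regular (A := A) (M := (in1 @* moved u.1)%G)) => //.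
- exact: normal_sign_kernel.
- exact: cyclic_abelian cyclic_sign_kernel.
- exact: abelian_sign_quotient.
- rewrite inE; apply/subsetP=> _ /imsetP[_ /morphimP[f _ Mf ->] ->].
  rewrite sdpair1J mem_morphim ?inE //=; apply/forallP=> i; rewrite ffunE.
  move/setXnP/(_ i): Mf; case: (e u.1 i) => [_|//]; exact: in_setT.
- rewrite gen_subG; apply/subsetP=> _ /imset2P[_ _ /morphimP[f _ _ ->] /set1P-> ->].
  rewrite commgEl sdpair1J -morphV ?inE // -morphM ?inE //.
  rewrite mem_morphim ?inE //=; apply/forallP=> i; rewrite !ffunE.
  by case: (e u.1 i); rewrite /= ?inE // mulVg.
(* Regularity: in an inverted coordinate, a fixed entry has order dividing both 2 and the odd prime
   [p i]; the other coordinates are trivial by definition of [moved]. *)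
apply/trivgP/subsetP=> _ /setIP[/morphimP[f _ Mf ->]].
move/cent1P/commgP/conjg_fixP; rewrite sdpair1J.
move/(injmP (injm_sdpair1 sign_groupAction) _ _ (in_setT _) (in_setT _)) => fixf.
suff -> : f = 1 by rewrite morph1 inE.
apply/ffunP=> i; rewrite oneg_ffun.
move/setXnP/(_ i): Mf; move/ffunP/(_ i): fixf; rewrite ffunE.
case: (e u.1 i) => [fiV _ | _ /set1P //].
have f2 : #[f i] %| 2 by rewrite order_dvdn expgS expg1 -{1}fiV mulVg.
have fp : #[f i] %| p i.
  by rewrite -[X in _ %| X]Zp_cast ?prime_gt1 // -[X in _ %| X]card_ord -cardsT order_dvdG ?inE.
apply/eqP; rewrite -order_eq1 -dvdn1.
have <- : gcdn 2 (p i) = 1%N by apply/eqP; rewrite -/(coprime 2 _) coprime2n.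
by rewrite dvdn_gcd f2.
Qed.

Lemma perm_primes_sub_class_sign (u : sdT) :
  perm_eq (primes #|sub_class [set: sdT]%G u|) [seq p i | i <- enum (e u.1)].
Proof. by rewrite card_sub_class_sign; exact: primes_prod_distinct. Qed.

Lemma size_rho_star_sign :
  size (rho_star [set: sdT]%G) = #|[pred i | [exists a, e a i]]|.
Proof.
have in2_1 a : (in2 a).1 = a by rewrite val_insubd !inE.
rewrite cardE -(size_map p); apply/perm_size/uniq_perm; first exact: undup_uniq.
  by rewrite map_inj_uniq ?enum_uniq.
move=> q; apply/mem_rho_star/mapP=> [[u _] | [i]].
  rewrite (perm_mem (perm_primes_sub_class_sign u)) => /mapP[i ei ->].
  by exists i; rewrite ?mem_enum ?inE //; apply/existsP; exists u.1; rewrite mem_enum in ei.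
rewrite mem_enum => /existsP[a eai] ->; exists (in2 a); rewrite ?inE //.
rewrite (perm_mem (perm_primes_sub_class_sign _)) in2_1.
by rewrite map_f // mem_enum.
Qed.

Lemma sigma_star_sign : sigma_star [set: sdT]%G = (\max_a #|e a|)%N.
Proof.
have in2_1 a : (in2 a).1 = a by rewrite val_insubd !inE.
have size_u (u : sdT) : size (primes #|sub_class [set: sdT]%G u|) = #|e u.1|.
  by rewrite (perm_size (perm_primes_sub_class_sign u)) size_map cardE.
apply/eqP; rewrite eqn_leq; apply/andP; split; apply/bigmax_leqP.
  by move=> u _; rewrite size_u leq_bigmax.
move=> a _; rewrite -{1}[a]in2_1 -size_u.
apply: (@leq_bigmax_cond _ _ (fun u : sdT => size (primes #|sub_class [set: sdT]%G u|))).
by rewrite inE.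
Qed.

Lemma supersolvable_sign : supersolvable [set: sdT]%G.
Proof.
exact: supersolvable_cyclic_by_abelian
  normal_sign_kernel cyclic_sign_kernel abelian_sign_quotient.
Qed.

Lemma metabelian_sign : metabelian [set: sdT]%G.
Proof.
apply: abelianS (cyclic_abelian cyclic_sign_kernel).
exact: der1_min (normal_norm normal_sign_kernel) abelian_sign_quotient.
Qed.

End SignAction.

(** * Counting zeros of linear forms over the field with two elements *)

Section DotProduct.

Import GRing.Theory.

Variable n : nat.
Implicit Types a v : 'rV['F_2]_n.+1.
Local Open Scope ring_scope.

(** A boolean suffices: over ['F_2] being nonzero is additive with respect to exclusive or, as the
    sign action demands. *)
Definition dot_neq0 a v : bool := \sum_j a 0 j * v 0 j != 0.

Lemma F2_neq0D (x y : 'F_2) : (x + y != 0) = (x != 0) (+) (y != 0).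
Proof. by case: x y => [[|[|]]] // ? [[|[|]]]. Qed.

Lemma dot_neq0M a b v : dot_neq0 (a * b)%g v = dot_neq0 a v (+) dot_neq0 b v.
Proof.
rewrite /dot_neq0 -F2_neq0D -big_split /=; congr (_ != 0).
by apply: eq_bigr => j _; rewrite FinRing.zmodMgE mxE mulrDl.
Qed.

Lemma dot_neq0C a v : dot_neq0 a v = dot_neq0 v a.
Proof.
by rewrite /dot_neq0; congr (_ != 0); apply: eq_bigr => j _; rewrite mulrC.
Qed.

Lemma dot_neq0_exists a : a != 0 -> exists v, dot_neq0 a v.
Proof.
case/rV0Pn=> j aj; exists (delta_mx 0 j).
rewrite /dot_neq0 (bigD1 j) //= big1 => [|k /negPf neq_kj].
  by rewrite mxE !eqxx mulr1 addr0.
by rewrite mxE neq_kj andbF mulr0.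
Qed.

Lemma dot0_neq0 v : dot_neq0 0 v = false.
Proof. by rewrite /dot_neq0 big1 ?eqxx // => j _; rewrite mxE mul0r. Qed.

(** Translation by a vector [w] with [dot_neq0 a w] exchanges the zeros and nonzeros of the form, so
    each set is half of the space. *)
Lemma card_dot_neq0 a : a != 0 -> #|dot_neq0 a| = (2 ^ n)%N.
Proof.
case/dot_neq0_exists=> w aw.
have half : #|dot_neq0 a| = #|[predC dot_neq0 a]|.
  rewrite -!sum1_card (reindex_inj (addrI w)); apply: eq_bigl => v.
  rewrite [RHS]inE -!topredE /= ![dot_neq0 a _]dot_neq0C.
  by rewrite -FinRing.zmodMgE dot_neq0M [dot_neq0 w a]dot_neq0C aw.
apply/eqP; rewrite -(eqn_pmul2l (isT : 0 < 2)%N) -expnS mul2n -addnn.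
by rewrite {2}half cardC card_mx card_Fp // mul1n.
Qed.

(** Only the zero form vanishes everywhere; its prime divides the order of the kernel but no
    sub-class size, whence the predecessor. *)
Lemma card_dot_neq0_exists :
  #|[pred v | [exists a, dot_neq0 a v]]| = (2 ^ n.+1).-1.
Proof.
rewrite (@eq_card _ _ (predC1 0)) => [|v].
  by rewrite cardC1 card_mx card_Fp // mul1n.
rewrite !inE; apply/existsP/idP=> [[a] | /dot_neq0_exists[a]].
  by apply: contraTneq => ->; rewrite dot_neq0C dot0_neq0.
by exists a; rewrite dot_neq0C.
Qed.

Lemma max_dot_neq0 : (\max_a #|dot_neq0 a| = 2 ^ n)%N.
Proof.
apply/eqP; rewrite eqn_leq; apply/andP; split.
  apply/bigmax_leqP=> a _; have [-> | /card_dot_neq0 -> //] := eqVneq a 0.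
  by rewrite eq_card0 // => v; exact: dot0_neq0.
(* Any nonzero vector attains the maximum; the all-ones vector is nonzero because the dimension
   [n.+1] is positive. *)
rewrite -(card_dot_neq0 (a := const_mx 1)); first exact: (@leq_bigmax _ (fun a => #|dot_neq0 a|)).
by apply/rV0Pn; exists 0; rewrite mxE oner_eq0.
Qed.

End DotProduct.

(** * A sequence of distinct odd primes *)

(** Starting at 3 and increasing strictly keeps every term above 2, hence odd. *)
Fixpoint odd_prime_seq (k : nat) : nat :=
  if k is k'.+1 then s2val (prime_above (odd_prime_seq k')) else 3.

Lemma odd_prime_seq_prime k : prime (odd_prime_seq k).
Proof. by case: k => //= k; case: prime_above. Qed.

Lemma odd_prime_seq_ltS k : odd_prime_seq k < odd_prime_seq k.+1.
Proof. by rewrite /=; case: prime_above. Qed.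

Lemma odd_prime_seq_inj : injective odd_prime_seq.
Proof.
have lt_q := homo_ltn ltn_trans odd_prime_seq_ltS.
by move=> i j eq_ij; case: (ltngtP i j) => // /lt_q; rewrite eq_ij ltnn.
Qed.

Lemma odd_prime_seq_odd k : odd (odd_prime_seq k).
Proof.
have gt2: 2 < odd_prime_seq k.
  by elim: k => // k IHk; exact: ltn_trans IHk (odd_prime_seq_ltS k).
by have [|//] := even_prime (odd_prime_seq_prime k) => eq2; rewrite eq2 in gt2.
Qed.

(** * The groups of the family *)

Section DotSignGroup.

Variable n : nat.

Definition dot_prime (v : 'rV['F_2]_n.+1) : nat := odd_prime_seq (enum_rank v).

Lemma dot_prime_prime v : prime (dot_prime v).
Proof. exact: odd_prime_seq_prime. Qed.

Lemma dot_prime_odd v : odd (dot_prime v).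
Proof. exact: odd_prime_seq_odd. Qed.

Lemma dot_prime_inj : injective dot_prime.
Proof. by move=> v w /odd_prime_seq_inj/val_inj/enum_rank_inj. Qed.

Lemma abelian_rV2 : abelian [set: 'rV['F_2]_n.+1].
Proof. exact: FinRing.zmod_abelian. Qed.

Definition dot_sign_type : finGroupType :=
  sdprod_by (sign_groupAction dot_prime (@dot_neq0M n)).

Definition dot_sign_group : {group dot_sign_type} := [set: dot_sign_type]%G.

Lemma supersolvable_dot_sign : supersolvable dot_sign_group.
Proof. exact: supersolvable_sign dot_prime_prime dot_prime_inj _ abelian_rV2. Qed.

Lemma metabelian_dot_sign : metabelian dot_sign_group.
Proof. exact: metabelian_sign dot_prime_prime dot_prime_inj _ abelian_rV2. Qed.

Lemma sigma_star_dot_sign : sigma_star dot_sign_group = (2 ^ n)%N.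
Proof.
rewrite (sigma_star_sign dot_prime_prime dot_prime_odd dot_prime_inj _ abelian_rV2).
exact: max_dot_neq0.
Qed.

Lemma size_rho_star_dot_sign : size (rho_star dot_sign_group) = (2 ^ n.+1).-1.
Proof.
rewrite (size_rho_star_sign dot_prime_prime dot_prime_odd dot_prime_inj _ abelian_rV2).
exact: card_dot_neq0_exists.
Qed.

End DotSignGroup.

(* The limit of the ratio *)
From mathcomp Require Import boolp classical_sets reals topology normedtype sequences.
Import numFieldNormedType.Exports.

Local Close Scope group_scope.
Local Open Scope classical_set_scope.
Local Open Scope ring_scope.

Section Ratio.

Import Order.TTheory GRing.Theory Num.Theory.

Lemma cvg_ratio (R : realType) :
  (((2 ^ n.+1).-1%:R / (2 ^ n)%:R : R) @[n --> \oo] --> (2 : R)).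
Proof.
have -> : (fun n => (2 ^ n.+1).-1%:R / (2 ^ n)%:R : R) = (fun n => 2 - 2^-1 ^+ n).
  apply/funext => n; have n2 : (2 ^ n)%:R != 0 :> R by rewrite pnatr_eq0 -lt0n expn_gt0.
  (* The truncated predecessor becomes a true subtraction because [2 ^ n.+1] is positive. *)
  rewrite -subn1 natrB ?expn_gt0 // mulrBl expnS natrM mulfK // mul1r.
  by rewrite natrX exprVn.
rewrite -[X in _ --> X]subr0; apply: cvgB; first exact: cvg_cst.
by apply: cvg_expr; rewrite ger0_norm ?invr_ge0 // invf_lt1 // ltr1n.
Qed.

End Ratio.

Theorem proposition5p1 (R : realType) :
  exists (gT : nat -> finGroupType) (G : forall n : nat, {group gT n}),
    (forall n : nat, (0 < n)%N ->
       [/\ supersolvable (G n), metabelian (G n) & (0 < sigma_star (G n))%N]) /\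
    ((size (rho_star (G n)))%:R / (sigma_star (G n))%:R : R) @[n --> \oo]
      --> (2 : R).
Proof.
exists dot_sign_type, dot_sign_group; split=> [n _|].
  split; [exact: supersolvable_dot_sign | exact: metabelian_dot_sign |].
  (* Positivity of the denominator ensures that the quotient is a genuine one, not the conventional
     value of division by zero. *)
  by rewrite sigma_star_dot_sign expn_gt0.
under eq_fun => n do rewrite sigma_star_dot_sign size_rho_star_dot_sign.
exact: cvg_ratio.
Qed.
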